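(* Assume that $X,Y$ are free and have symmetric distributions with respect to a unital linear functional $\mu:\mathbb{C}\langle X,Y\rangle\to\mathbb{C}$. For $\alpha\in\mathbb{C}$ let $T_\alpha=\alpha XY+\overline{\alpha}YX$. If $|\alpha|=1$, then the conditional expectations $\mathbb{E}_X[(1-zT_\alpha)^{-1}]$ and $\mathbb{E}_Y[(1-zT_\alpha)^{-1}]$ do not depend on $\alpha$ and are equal to $\mathbb{E}_X[(1-zT_1)^{-1}]$ and $\mathbb{E}_Y[(1-zT_1)^{-1}]$, respectively. In particular, the conditional expectations of the resolvents of the commutator $i(XY-YX)$ and of the anticommutator $XY+YX$ coincide.
   Context: $(1-zT_\alpha)^{-1}=\sum_{k\ge0}z^kT_\alpha^k$ is regarded as a formal power series in $z$ with coefficients in $\mathbb{C}\langle X,Y\rangle$, and conditional expectations are applied coefficientwise. $X$ and $Y$ are free: $\mu(u_1\cdots u_r)=0$ whenever $r\ge1$, $\mu(u_j)=0$ for all $j$ and the $u_j$ come alternatingly from $\mathbb{C}[X]$ and $\mathbb{C}[Y]$. Symmetric: $\mu(X^{k})=\mu(Y^k)=0$ for all odd $k$. Boolean cumulants: multilinear functionals $\beta_n$ with $\mu(c_1\cdots c_n)=\sum_{k=1}^n\beta_k(c_1,\dots,c_k)\mu(c_{k+1}\cdots c_n)$ (empty product $=1$). The formal conditional expectation $\mathbb{E}_X:\mathbb{C}\langle X,Y\rangle\to\mathbb{C}[X]$ is the linear map with $\mathbb{E}_X[1]=1$, $\mathbb{E}_X[bwb']=b\mathbb{E}_X[w]b'$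 for $b,b'\in\mathbb{C}[X]$, and, for $a_i\in\{Y^k:k\ge1\}$, $b_i\in\{X^k:k\ge1\}$, $$\mathbb{E}_X[a_1b_1a_2\cdots b_{n-1}a_n]=\sum_{k=0}^{n-1}\sum_{1\le i_1<\dots<i_k\le n-1}b_{i_1}\cdots b_{i_k}\prod_{j=0}^k\beta_{2(i_{j+1}-i_j)-1}(a_{i_j+1},b_{i_j+1},a_{i_j+2},\dots,a_{i_{j+1}}),\quad i_0=0,\ i_{k+1}=n.$$ It satisfies $\mu(\mathbb{E}_X[w]b)=\mu(wb)$ for $b\in\mathbb{C}[X]$. $\mathbb{E}_Y$ is defined with the roles of $X$ and $Y$ exchanged. *)

(* Defs.v *)
From HB Require Import structures.
From mathcomp Require Import all_boot all_order all_algebra.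
From mathcomp Require Import finmap monalg complex.
From mathcomp Require Import reals.
Set Implicit Arguments.
Unset Strict Implicit.
Unset Printing Implicit Defensive.
Import GRing.Theory Num.Theory.
Local Open Scope ring_scope.

Section PolynomialSubalgebra.

Variables (K : fieldType) (B : lalgType K).

(* u lies in K[g] *)
Definition in_polyalg (g u : B) : Prop :=
  exists p : {poly K}, u = \sum_(i < size p) p`_i *: g ^+ i.

Variable g : B.

Lemma in_polyalg_exp n : in_polyalg g (g ^+ n).
Proof.
exists 'X^n; rewrite size_polyXn (bigD1 ord_max) //= coefXn eqxx scale1r.
rewrite big1 ?addr0 // => i ni; rewrite coefXn.
by have /negPf-> : i != n :> nat by []; rewrite scale0r.
Qed.

Lemma in_polyalg_lin (c : K) (u v : B) :
  in_polyalg g u -> in_polyalg g v -> in_polyalg g (c *: u + v).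
Proof.
have widen (p : {poly K}) n : (size p <= n)%N ->
    \sum_(i < size p) p`_i *: g ^+ i = \sum_(i < n) p`_i *: g ^+ i.
  move=> pn; rewrite (big_ord_widen n (fun i => p`_i *: g ^+ i) pn).
  rewrite big_mkcond; apply: eq_bigr => i _; case: ltnP => // pi.
  by rewrite nth_default // scale0r.
move=> [p ->] [q ->]; exists (c *: p + q).
set n := maxn (size p) (size q).
have npq : (size (c *: p + q)%R <= n)%N.
  rewrite (leq_trans (size_polyD _ _)) // geq_max leq_maxr andbT.
  by rewrite (leq_trans (size_scale_leq _ _)) // leq_maxl.
rewrite (widen p n) ?leq_maxl // (widen q n) ?leq_maxr // (widen _ n) //.
rewrite scaler_sumr -big_split; apply: eq_bigr => i _ /=.
by rewrite coefD coefZ scalerDl scalerA.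
Qed.

Lemma in_polyalg_ind (P : B -> Prop) : P 0 ->
  (forall c u v, P u -> P v -> P (c *: u + v)) ->
  (forall n, P (g ^+ n)) -> forall u, in_polyalg g u -> P u.
Proof.
move=> P0 PD PX _ [p ->]; apply: (big_ind P) => // [u v Pu Pv|i _].
  by rewrite -[u]scale1r; apply: PD.
by rewrite -[_ *: _]addr0; apply: PD.
Qed.

Lemma in_polyalg0 : in_polyalg g 0.
Proof. by exists 0; rewrite size_poly0 big_ord0. Qed.

Lemma in_polyalgZ c u : in_polyalg g u -> in_polyalg g (c *: u).
Proof.
by move=> pu; rewrite -[_ *: _]addr0; apply: in_polyalg_lin => //; apply: in_polyalg0.
Qed.

Lemma in_polyalg_sum (I : Type) (r : seq I) (P : pred I) (F : I -> B) :
  (forall i, P i -> in_polyalg g (F i)) -> in_polyalg g (\sum_(i <- r | P i) F i).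
Proof.
move=> FP; apply: (big_ind (in_polyalg g)) => //; first exact: in_polyalg0.
by move=> u v pu pv; rewrite -[u]scale1r; apply: in_polyalg_lin.
Qed.

Lemma linear_sumE (h : B -> B) (I : Type) (r : seq I) (c : I -> K) (F : I -> B) :
  linear h -> h (\sum_(i <- r) c i *: F i) = \sum_(i <- r) c i *: h (F i).
Proof.
move=> lh; pose hM := GRing.isLinear.Build K B B _ h lh.
pose hL : {linear B -> B} := HB.pack h hM.
rewrite -[h]/(hL : B -> B) linear_sum; apply: eq_bigr => i _.
exact: linearZ.
Qed.

Lemma linear_sum_ext (h h' : B -> B) (I : Type) (r : seq I) (c : I -> K)
    (F : I -> B) : linear h -> linear h' -> (forall i, h (F i) = h' (F i)) ->
  h (\sum_(i <- r) c i *: F i) = h' (\sum_(i <- r) c i *: F i).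
Proof.
by move=> lh lh' hh'; rewrite !linear_sumE //; apply: eq_bigr => i _; rewrite hh'.
Qed.

Hypothesis scaleAr : forall (c : K) (u v : B), u * (c *: v) = c *: (u * v).

Lemma in_polyalgM u v : in_polyalg g u -> in_polyalg g v -> in_polyalg g (u * v).
Proof.
move=> pu pv; move: u pu; apply: in_polyalg_ind => [|c u u' pu pu'|n].
- by rewrite mul0r; apply: in_polyalg0.
- by rewrite mulrDl -scalerAl; apply: in_polyalg_lin.
move: v pv; apply: in_polyalg_ind => [|c u u' pu pu'|m].
- by rewrite mulr0; apply: in_polyalg0.
- by rewrite mulrDr scaleAr; apply: in_polyalg_lin.
by rewrite -exprD; apply: in_polyalg_exp.
Qed.

Lemma linear_mul_gen (E : {linear B -> B}) :
  [/\ linear (fun u => E (g * u)), linear (fun u => g * E u),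
      linear (fun u => E (u * g)) & linear (fun u => E u * g)].
Proof.
split=> c u v.
- by rewrite mulrDr scaleAr linearP.
- by rewrite linearP mulrDr scaleAr.
- by rewrite mulrDl -scalerAl linearP.
- by rewrite linearP mulrDl -scalerAl.
Qed.

Lemma bimodule_gen (E : {linear B -> B}) :
  (forall u, E (g * u) = g * E u) -> (forall u, E (u * g) = E u * g) ->
  forall b w b', in_polyalg g b -> in_polyalg g b' ->
  E (b * w * b') = b * E w * b'.
Proof.
move=> El Er b w b' pb pb'; have left : E (b * w) = b * E w.
  move: b pb; apply: in_polyalg_ind => [|c u v Pu Pv|n].
  - by rewrite !mul0r linear0.
  - by rewrite !mulrDl -!scalerAl linearP Pu Pv.
  elim: n => [|n IH]; first by rewrite !mul1r.
  by rewrite exprS -!mulrA El IH.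
rewrite -left; move: b' pb'; apply: in_polyalg_ind => [|c u v Pu Pv|n].
- by rewrite !mulr0 linear0.
- by rewrite !mulrDr !scaleAr linearP Pu Pv.
elim: n => [|n IH]; first by rewrite !mulr1.
by rewrite exprSr !mulrA Er IH.
Qed.

End PolynomialSubalgebra.

(* The two indeterminates are indexed by bool: false for X, true for Y, so that
   ~~ x is the index of the other one. *)
Notation ncpoly K := {malg K[{fmonom bool}]}.

Section FreeProbability.

Variable K : fieldType.
Local Notation A := (ncpoly K).
Implicit Types (mu : {scalar A}) (x : bool).

Definition gen x : A := << fmu x >>.

(* The j-th factor, counted from 0, is a polynomial in the indeterminate x when
   j is even and in the other one when j is odd. *)
Definition freely_independent mu : Prop :=
  forall x (u : seq A), u != [::] ->
    (forall j, (j < size u)%N ->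
       in_polyalg (gen (x (+) odd j)) u`_j /\ mu u`_j = 0) ->
  mu (\prod_(c <- u) c) = 0.

Definition symmetric_distribution mu x : Prop :=
  forall k, odd k -> mu (gen x ^+ k) = 0.

(* The moment recursion solved for its term of index k = n; d only bounds
   the recursion depth. *)
Fixpoint boolean_cumulant_rec mu (d : nat) (c : seq A) : K :=
  if d is d'.+1 then
    mu (\prod_(u <- c) u) -
    \sum_(1 <= k < size c)
       boolean_cumulant_rec mu d' (take k c) * mu (\prod_(u <- drop k c) u)
  else 0.

Definition boolean_cumulant mu (c : seq A) : K :=
  boolean_cumulant_rec mu (size c) c.

(* [:: a_{p+1}; b_{p+1}; a_{p+2}; ...; b_{q-1}; a_q], for p < q *)
Definition alternating (a b : nat -> A) (p q : nat) : seq A :=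
  a p.+1 :: flatten [seq [:: b r; a r.+1] | r <- index_iota p.+1 q].

(* The tuple i lists i_1 < ... < i_k, all in {1, ..., n-1}. *)
Definition cond_exp_formula mu (a b : nat -> A) (n : nat) : A :=
  \sum_(k < n) \sum_(i : k.-tuple 'I_n | path ltn 0 (map val i))
    (\prod_(j < k.+1)
       boolean_cumulant mu
         (alternating a b (nth 0%N (0%N :: map val i) j)
                          (nth 0%N (rcons (map val i) n) j))) *:
    \prod_(r <- map val i) b r.

Record is_cond_exp mu x (E : {linear A -> A}) : Prop := IsCondExp {
  cond_exp_range : forall w, in_polyalg (gen x) (E w);
  cond_exp1 : E 1 = 1;
  cond_exp_bimodule : forall b w b', in_polyalg (gen x) b -> in_polyalg (gen x) b' ->
    E (b * w * b') = b * E w * b';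
  cond_exp_alternating : forall (n : nat) (p q : nat -> nat), (0 < n)%N ->
    (forall i, 0 < p i)%N -> (forall i, 0 < q i)%N ->
    let a i := gen (~~ x) ^+ p i in
    let b i := gen x ^+ q i in
    E (\prod_(c <- alternating a b 0 n) c) = cond_exp_formula mu a b n }.

(* (1 - z T)^{-1} as the sequence of its coefficients in z *)
Definition resolvent (T : A) : nat -> A := fun k => T ^+ k.

Lemma boolean_cumulant_rec_stable mu d e (c : seq A) :
  (0 < size c)%N -> (size c <= d)%N -> (size c <= e)%N ->
  boolean_cumulant_rec mu d c = boolean_cumulant_rec mu e c.
Proof.
elim: d e c => [|d IH] [|e] c; do ?by case: (size c).
move=> c0 lcd lce /=; congr (_ - _).
apply: eq_big_nat => k /andP[k0 kc]; congr (_ * _).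
by apply: IH; rewrite size_takel ?(ltnW kc) // -ltnS (leq_trans kc).
Qed.

Lemma boolean_cumulant_moment mu (c : seq A) : mu 1 = 1 -> (0 < size c)%N ->
  mu (\prod_(u <- c) u) =
  \sum_(1 <= k < (size c).+1)
     boolean_cumulant mu (take k c) * mu (\prod_(u <- drop k c) u).
Proof.
move=> mu1 c0; have bcE : boolean_cumulant mu c = mu (\prod_(u <- c) u) -
    \sum_(1 <= k < size c)
       boolean_cumulant mu (take k c) * mu (\prod_(u <- drop k c) u).
  rewrite [LHS]/boolean_cumulant; case sc: (size c) c0 => [//|n] _ /=.
  rewrite sc; congr (_ - _).
  apply: eq_big_nat => k /andP[k0 kc]; congr (_ * _).
  by apply: boolean_cumulant_rec_stable; rewrite size_takel ?sc // ltnW.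
rewrite big_nat_recr //= take_size drop_size big_nil mu1 mulr1.
by rewrite bcE addrC subrK.
Qed.

(* Existence and uniqueness of the conditional expectation: a word is cut as
   x^p y^{k_1} x^{l_1} ... y^{k_n} x^{l_n} with y = ~~ x, where the k_i are
   positive and only l_n may vanish. *)

Fixpoint blocks x (w : seq bool) : nat * seq (nat * nat) :=
  if w is c :: w' then
    let: (p, L) := blocks x w' in
    if c == x then (p.+1, L) else
    if p is 0 then
      if L is (k, l) :: L' then (0%N, (k.+1, l) :: L') else (0%N, [:: (1%N, 0%N)])
    else (0%N, (1%N, p) :: L)
  else (0%N, [::]).

Definition block_word x (L : seq (nat * nat)) : seq bool :=
  flatten [seq nseq kl.1 (~~ x) ++ nseq kl.2 x | kl <- L].

Fixpoint proper (L : seq (nat * nat)) : bool :=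
  if L is (k, l) :: L' then [&& (0 < k)%N, (L' == [::]) || (0 < l)%N & proper L']
  else true.

Definition blocks_exp mu x (L : seq (nat * nat)) : A :=
  if L is [::] then 1 else
  cond_exp_formula mu
    (fun i => gen (~~ x) ^+ (nth (0%N, 0%N) L i.-1).1)
    (fun i => gen x ^+ (nth (0%N, 0%N) L i.-1).2) (size L)
  * gen x ^+ (last (0%N, 0%N) L).2.

Definition word_exp mu x (w : seq bool) : A :=
  let: (p, L) := blocks x w in gen x ^+ p * blocks_exp mu x L.

Definition cond_exp mu x (u : A) : A :=
  \sum_(w <- msupp u) u@_w *: word_exp mu x w.

Lemma ncpolyZr (c : K) (u v : A) : u * (c *: v) = c *: (u * v).
Proof.
have central : u * c%:MP = c%:MP * u.
  rewrite !malgM_def fgmulgU fgmulUg; apply: eq_bigr => w _.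
  by rewrite mulrC mulm1 mul1m.
by rewrite -(mul_malgC c v) mulrA central -mulrA mul_malgC.
Qed.

Lemma msuppD_sub (c : K) (u v : A) (d : {fset {fmonom bool}}) :
  (msupp u `<=` d)%fset -> (msupp v `<=` d)%fset ->
  (msupp (c *: u + v) `<=` d)%fset.
Proof.
move=> ud vd; apply: fsubset_trans (msuppD_le _ _) _.
by rewrite fsubUset vd andbT (fsubset_trans (msuppZ_le _ _)).
Qed.

Lemma cond_expEw mu x (d : {fset {fmonom bool}}) (u : A) :
  (msupp u `<=` d)%fset ->
  cond_exp mu x u = \sum_(w <- d) u@_w *: word_exp mu x w.
Proof.
move=> ud; rewrite [LHS](big_fset_incl _ ud) => //= w _ /mcoeff_outdom ->.
by rewrite scale0r.
Qed.

Lemma cond_exp_is_linear mu x : linear (cond_exp mu x).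
Proof.
move=> c u v; set d := (msupp u `|` msupp v)%fset.
have ud : (msupp u `<=` d)%fset by apply: fsubsetUl.
have vd : (msupp v `<=` d)%fset by apply: fsubsetUr.
rewrite (cond_expEw _ _ ud) (cond_expEw _ _ vd).
rewrite (cond_expEw _ _ (msuppD_sub c ud vd)).
rewrite scaler_sumr -big_split; apply: eq_bigr => w _ /=.
by rewrite mcoeffD mcoeffZ scalerDl scalerA.
Qed.

HB.instance Definition _ mu x :=
  GRing.isLinear.Build K A A _ (cond_exp mu x) (cond_exp_is_linear mu x).

Definition mon (w : seq bool) : A := << FMonom w >>.

Lemma mon_cat v w : mon (v ++ w) = mon v * mon w.
Proof. by rewrite /mon malgM_def fgmulUU mulr1 /mmul /= /mul /= fmmulE. Qed.

Lemma mon_nil : mon [::] = 1.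
Proof. by rewrite /mon -fmoneE. Qed.

Lemma mon_gen x : mon [:: x] = gen x.
Proof. by rewrite /mon /gen fmuE. Qed.

Lemma mon_nseq n x : mon (nseq n x) = gen x ^+ n.
Proof.
elim: n => [|n IH]; first exact: mon_nil.
by rewrite exprS -IH -mon_gen -mon_cat.
Qed.

Lemma ncpolyE (u : A) : u = \sum_(w <- msupp u) u@_w *: mon w.
Proof.
rewrite {1}[u]monalgE; apply: eq_bigr => -[w] _.
by rewrite -mul_malgC /mon malgM_def fgmulUU mulr1 mul1m.
Qed.

Lemma cond_exp_mon mu x w : cond_exp mu x (mon w) = word_exp mu x w.
Proof. by rewrite /cond_exp msuppU1 big_seq_fset1 mcoeffUU scale1r. Qed.

Lemma linear_ext (f f' : A -> A) : linear f -> linear f' ->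
  (forall w, f (mon w) = f' (mon w)) -> f =1 f'.
Proof.
move=> lf lf' ff' u; rewrite [u]ncpolyE.
exact: linear_sum_ext.
Qed.

Lemma alternating_ext (a b a' b' : nat -> A) p q : (p < q)%N ->
  (forall i, 0 < i <= q -> a i = a' i)%N ->
  (forall i, 0 < i < q -> b i = b' i)%N ->
  alternating a b p q = alternating a' b' p q.
Proof.
move=> pq aa bb; rewrite /alternating aa //; congr (_ :: flatten _).
apply/eq_in_map => r; rewrite mem_index_iota => /andP[pr rq].
by rewrite bb ?aa // rq andbT (leq_ltn_trans _ pr).
Qed.

Lemma cond_exp_formula_ext mu (a b a' b' : nat -> A) n :
  (forall i, 0 < i <= n -> a i = a' i)%N ->
  (forall i, 0 < i < n -> b i = b' i)%N ->
  cond_exp_formula mu a b n = cond_exp_formula mu a' b' n.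
Proof.
move=> aa bb; rewrite /cond_exp_formula.
apply: eq_bigr => k _; apply: eq_bigr => i pi; congr (_ *: _); last first.
  apply: eq_big_seq => r ri; apply: bb.
  rewrite (allP (order_path_min ltn_trans pi) r ri) /=.
  by case/mapP: ri => j _ ->; apply: ltn_ord.
apply: eq_bigr => j _; congr boolean_cumulant.
have szi : size (map val i) = k by rewrite size_map size_tuple.
have jk : (j < (size (map val i)).+1)%N by rewrite szi.
have le_n : (nth 0%N (rcons (map val i) n) j <= n)%N.
  have : nth 0%N (rcons (map val i) n) j \in rcons (map val i) n.
    by rewrite mem_nth // size_rcons.
  rewrite mem_rcons inE => /predU1P[->//|/mapP[r _ ->]].
  by apply: ltnW; apply: ltn_ord.
apply: alternating_ext.
- have : path ltn 0 (rcons (map val i) n).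
    rewrite rcons_path pi /=; have: last 0%N (map val i) \in 0%N :: map val i.
      exact: mem_last.
    rewrite inE => /predU1P[->|/mapP[r _ ->]]; last exact: ltn_ord.
    exact: leq_ltn_trans (ltn_ord k).
  move/(pathP 0%N) => /(_ j); rewrite size_rcons => /(_ jk).
  by rewrite -rcons_cons nth_rcons /= jk.
- by move=> r /andP[r0 rn]; apply: aa; rewrite r0 (leq_trans rn).
- by move=> r /andP[r0 rn]; apply: bb; rewrite r0 (leq_trans rn).
Qed.

Lemma blocks_nseq x l w :
  blocks x (nseq l x ++ w) = ((l + (blocks x w).1)%N, (blocks x w).2).
Proof.
elim: l => [|l IH] /=; first by case: (blocks x w).
by rewrite IH eqxx.
Qed.

Lemma blocks_word x p L : proper L ->
  blocks x (nseq p x ++ block_word x L) = (p, L).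
Proof.
move=> pL; rewrite blocks_nseq; suff -> : blocks x (block_word x L) = (0%N, L).
  by rewrite addn0.
elim: L pL {p} => [|[k l] L IH] //= /and3P[k0 Ll pL].
rewrite /block_word /= -/(block_word x L) -catA.
elim: k k0 => [//|k IHk] _ /=; have yx : (~~ x == x) = false by case: (x).
rewrite yx; case: k IHk => [_|k -> //] /=.
rewrite blocks_nseq IH //= addn0; case: l Ll => [|l] //=.
by rewrite orbF => /eqP->.
Qed.

Lemma blocksP x w : exists p L,
  [/\ blocks x w = (p, L), w = nseq p x ++ block_word x L & proper L].
Proof.
elim: w => [|c w [p [L [/= -> wE pL]]]]; first by exists 0%N, [::].
case: eqP => [->|/eqP cx]; first by exists p.+1, L; rewrite wE.
have {cx}-> : c = ~~ x by case: (c) (x) cx => [] [].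
case: p wE => [|p] /= ->.
  case: L pL => [|[k l] L] /= pL; first by exists 0%N, [:: (1%N, 0%N)].
  exists 0%N, ((k.+1, l) :: L); split=> //=.
  by case/and3P: pL => _ -> ->.
by exists 0%N, ((1%N, p.+1) :: L); rewrite /= pL orbT.
Qed.

Lemma proper_rcons L k l l' : proper (rcons L (k, l)) -> proper (rcons L (k, l')).
Proof.
elim: L => [|[k1 l1] L IH] /=; first by rewrite !andbT.
by move=> /and3P[-> h /IH->]; rewrite andbT; case: L {IH} h.
Qed.

Lemma block_word_rcons x L k l :
  block_word x (rcons L (k, l.+1)) = rcons (block_word x (rcons L (k, l))) x.
Proof.
rewrite /block_word !map_rcons !flatten_rcons /= -!cats1 -!catA.
by rewrite -(nseqD l 1) addn1.
Qed.

Lemma blocks_exp_rconsE mu x L k l :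
  blocks_exp mu x (rcons L (k, l)) = cond_exp_formula mu
    (fun i => gen (~~ x) ^+ (nth (0%N, 0%N) (rcons L (k, l)) i.-1).1)
    (fun i => gen x ^+ (nth (0%N, 0%N) (rcons L (k, l)) i.-1).2) (size L).+1
  * gen x ^+ l.
Proof.
have blE M : M != [::] -> blocks_exp mu x M = cond_exp_formula mu
    (fun i => gen (~~ x) ^+ (nth (0%N, 0%N) M i.-1).1)
    (fun i => gen x ^+ (nth (0%N, 0%N) M i.-1).2) (size M)
  * gen x ^+ (last (0%N, 0%N) M).2 by case: M.
by rewrite blE ?last_rcons ?size_rcons //; case: L.
Qed.

Lemma blocks_exp_rcons mu x L k l :
  blocks_exp mu x (rcons L (k, l.+1)) = blocks_exp mu x (rcons L (k, l)) * gen x.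
Proof.
rewrite !blocks_exp_rconsE -mulrA -exprSr.
apply: (congr1 (fun u => u * gen x ^+ l.+1)).
apply: cond_exp_formula_ext => i /andP[]; case: i => // i _; rewrite ltnS => il.
  by rewrite /= !nth_rcons; case: (ltngtP i (size L)) il.
by rewrite /= !nth_rcons il.
Qed.

Lemma word_exp_left mu x w : word_exp mu x (x :: w) = gen x * word_exp mu x w.
Proof.
rewrite /word_exp /=; case: (blocks x w) => p L; rewrite eqxx.
by rewrite exprS mulrA.
Qed.

Lemma word_exp_right mu x w :
  word_exp mu x (rcons w x) = word_exp mu x w * gen x.
Proof.
have [p [L [bw wE pL]]] := blocksP x w; rewrite {2}/word_exp bw wE.
case/lastP: L pL {bw wE} => [|L [k l]] pL.
  have wE n : word_exp mu x (nseq n x) = gen x ^+ n.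
    have := @blocks_word x n [::] isT; rewrite cats0 /word_exp => ->.
    exact: mulr1.
  have -> : nseq p x ++ block_word x [::] = nseq p x by apply: cats0.
  have -> : rcons (nseq p x) x = nseq p.+1 x.
    by rewrite -cats1 -(nseqD p 1) addn1.
  have -> : blocks_exp mu x [::] = 1 by [].
  by rewrite !wE mulr1 exprSr.
rewrite rcons_cat -block_word_rcons /word_exp.
by rewrite (blocks_word x p (proper_rcons l.+1 pL)) blocks_exp_rcons mulrA.
Qed.

Lemma cond_exp_left mu x (u : A) :
  cond_exp mu x (gen x * u) = gen x * cond_exp mu x u.
Proof.
have [l l' _ _] := linear_mul_gen (gen x) ncpolyZr (cond_exp mu x).
suff lw w : cond_exp mu x (gen x * mon w) = gen x * cond_exp mu x (mon w).
  exact: (linear_ext l l' lw).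
rewrite -mon_gen -mon_cat cond_exp_mon cond_exp_mon mon_gen.
exact: word_exp_left.
Qed.

Lemma cond_exp_right mu x (u : A) :
  cond_exp mu x (u * gen x) = cond_exp mu x u * gen x.
Proof.
have [_ _ l l'] := linear_mul_gen (gen x) ncpolyZr (cond_exp mu x).
suff lw w : cond_exp mu x (mon w * gen x) = cond_exp mu x (mon w) * gen x.
  exact: (linear_ext l l' lw).
rewrite -mon_gen -mon_cat cond_exp_mon cond_exp_mon mon_gen cats1.
exact: word_exp_right.
Qed.

Lemma alternating_mon x (p q : nat -> nat) s m :
  \prod_(c <- alternating (fun i => gen (~~ x) ^+ p i) (fun i => gen x ^+ q i)
                s (s + m).+1) c
  = mon (block_word x (rcons [seq (p r, q r) | r <- iota s.+1 m]
                             (p (s + m).+1, 0%N))).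
Proof.
rewrite /alternating /index_iota subSS addKn.
elim: m s => [|m IH] s.
  by rewrite addn0 big_seq1 /block_word /= !cats0 mon_nseq.
have := IH s.+1; rewrite /= addSnnS => {}IH.
by rewrite /block_word /= -/(block_word x _) !mon_cat !mon_nseq 2!big_cons IH mulrA.
Qed.

Lemma word_exp_range mu x w : in_polyalg (gen x) (word_exp mu x w).
Proof.
have polyM := in_polyalgM (g := gen x) ncpolyZr.
rewrite /word_exp; case: (blocks x w) => p L.
apply: (polyM); first exact: in_polyalg_exp.
case: L => [|L0 L]; first exact: (in_polyalg_exp _ 0).
apply: (polyM); last exact: in_polyalg_exp.
apply: in_polyalg_sum => k _; apply: in_polyalg_sum => i _.
apply: in_polyalgZ; apply: big_ind => [|u v|j _]; last exact: in_polyalg_exp.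
  exact: (in_polyalg_exp _ 0).
exact: polyM.
Qed.

Lemma cond_expP mu x : is_cond_exp mu x (cond_exp mu x).
Proof.
split.
- move=> w; apply: in_polyalg_sum => v _; apply: in_polyalgZ.
  exact: word_exp_range.
- by rewrite -[in LHS]mon_nil [LHS]cond_exp_mon; exact: mulr1.
- apply: (bimodule_gen ncpolyZr); first exact: cond_exp_left.
  exact: cond_exp_right.
- move=> [//|m] p q _ p0 q0 a b.
  have := alternating_mon x p q 0 m; rewrite add0n => ->.
  set L := [seq (p r, q r) | r <- iota 1 m].
  have szL : size L = m by rewrite size_map size_iota.
  have pL : proper (rcons L (p m.+1, 0%N)).
    move: (p m.+1) (p0 m.+1) => e e0; rewrite /L.
    by elim: m 1%N {L szL} => [|d IH] s /=; rewrite ?e0 ?p0 ?q0 ?orbT ?IH.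
  transitivity (word_exp mu x (block_word x (rcons L (p m.+1, 0%N)))).
    exact: cond_exp_mon.
  rewrite /word_exp (blocks_word x 0 pL : blocks x (block_word _ _) = _) mul1r.
  rewrite blocks_exp_rconsE szL expr0 mulr1.
  apply: cond_exp_formula_ext => i /andP[]; case: i => // i _; rewrite ltnS => im.
    rewrite /a /= nth_rcons szL; case: ltngtP im => // [im _|-> //].
    by rewrite (nth_map 0%N) ?size_iota // nth_iota.
  by rewrite /b /= nth_rcons szL im (nth_map 0%N) ?size_iota // nth_iota.
Qed.

Lemma cond_exp_unique mu x (E : {linear A -> A}) :
  is_cond_exp mu x E -> E =1 cond_exp mu x.
Proof.
move=> EP; have FP := cond_expP mu x.
apply: linear_ext => [||w]; [exact: linearP | exact: linearP |].
have [p [L [_ -> pL]]] := blocksP x w; rewrite mon_cat mon_nseq.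
have pX n : in_polyalg (gen x) (gen x ^+ n : A) by exact: in_polyalg_exp.
case/lastP: L pL => [|L [k l]] pL.
  have fixX (F : {linear A -> A}) : is_cond_exp mu x F ->
      F (gen x ^+ p) = gen x ^+ p.
    move=> HF; have := cond_exp_bimodule HF 1 (pX p) (pX 0%N).
    by rewrite expr0 !mulr1 (cond_exp1 HF) mulr1.
  have -> : gen x ^+ p * mon (block_word x [::]) = gen x ^+ p.
    by rewrite mon_nil mulr1.
  exact: etrans (fixX _ EP) (esym (fixX _ FP)).
have -> : block_word x (rcons L (k, l)) =
          block_word x (rcons L (k, 0%N)) ++ nseq l x.
  by rewrite /block_word !map_rcons !flatten_rcons /= cats0 catA.
rewrite mon_cat mon_nseq mulrA; set W := block_word x _.
suff EW : E (mon W) = cond_exp mu x (mon W).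
  apply: etrans (cond_exp_bimodule EP (mon W) (pX p) (pX l)) _; rewrite EW.
  exact: esym (cond_exp_bimodule FP (mon W) (pX p) (pX l)).
rewrite {}/W.
pose P i := if (nth (1%N, 1%N) (rcons L (k, 1%N)) i.-1).1 is j.+1 then j.+1 else 1%N.
pose Q i := if (nth (1%N, 1%N) (rcons L (k, 1%N)) i.-1).2 is j.+1 then j.+1 else 1%N.
have LE : rcons [seq (P r, Q r) | r <- iota 1 (size L)] (P (size L).+1, 0%N)
        = rcons L (k, 0%N).
  have {}pL : proper (rcons L (k, 1%N)) by apply: proper_rcons pL.
  have pos i : (i < size (rcons L (k, 1%N)))%N ->
      let kl := nth (1%N, 1%N) (rcons L (k, 1%N)) i in (0 < kl.1)%N && (0 < kl.2)%N.
    elim: L i pL {P Q} => [|[k1 l1] L IH] [|i] //=; rewrite ?andbT.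
    - by move=> /and3P[-> /orP[/eqP|->] //]; case: (L).
    - by move=> /and3P[_ _ /IH]; apply.
  congr rcons; last by rewrite /P /= nth_rcons ltnn eqxx /=;
    have := pos (size L); rewrite size_rcons ltnSn nth_rcons ltnn eqxx => /(_ isT);
    case: (k).
  apply: (@eq_from_nth _ (1%N, 1%N)); rewrite size_map size_iota // => i iL.
  rewrite (nth_map 0%N) ?size_iota // nth_iota //.
  have := pos i; rewrite size_rcons ltnW // => /(_ isT).
  by rewrite /P /Q /= nth_rcons iL; case: (nth _ _ _) => [[|?] [|?]].
have Ppos i : (0 < P i)%N by rewrite /P; case: (nth _ _ _).1.
have Qpos i : (0 < Q i)%N by rewrite /Q; case: (nth _ _ _).2.
have := alternating_mon x P Q 0 (size L); rewrite add0n LE => <-.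
apply: etrans (cond_exp_alternating EP _ Ppos Qpos) _ => //.
exact: esym (cond_exp_alternating FP _ Ppos Qpos).
Qed.

End FreeProbability.

Definition T_ (C : numClosedFieldType) (alpha : C) : ncpoly C :=
  alpha *: (gen C false * gen C true) + alpha^* *: (gen C true * gen C false).

(* Main.v *)
(* Write d_y(w) for the number of occurrences of y at even positions of the word w
   (counted from 0) minus the number at odd positions.  Expanding the vanishing moment of the
   centred blocks of w, all other terms arise by deleting blocks of nonzero
   moment, which have even length by symmetry; such deletions preserve both d_y
   and the parity of the length.  By induction on the length, mu(w) = 0 unless w
   is balanced: of even length with d_y(w) = 0.  As balanced words are closed
   under concatenation and under left cancellation, Boolean cumulants inherit
   this, and then E_x[w] = 0 unless d_{~~ x}(w) = 0.  In the expansion of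
   T_alpha^k a word w in XY and YX has coefficient alpha^(d_X(w)), and
   d_X(w) = - d_Y(w), so only words of coefficient 1 contribute. *)
Require Import Defs.
From HB Require Import structures.
From mathcomp Require Import all_boot all_order all_algebra.
From mathcomp Require Import finmap monalg complex.
From mathcomp Require Import reals.
Set Implicit Arguments.
Unset Strict Implicit.
Unset Printing Implicit Defensive.
Import GRing.Theory Num.Theory.
Local Open Scope ring_scope.

(** * Alternating letter counts and block decompositions of words *)

Section SignedCount.

Implicit Types (x y : bool) (v w : seq bool).

(** This is d_y(w): prepending a letter shifts the tail by one position, hence the minus sign. *)
Fixpoint signed_count y w : int :=
  if w is c :: w' then (c == y)%:R - signed_count y w' else 0.

Lemma signed_count_cat y v w :
  signed_count y (v ++ w) =
  signed_count y v + (-1) ^+ odd (size v) * signed_count y w.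
Proof.
elim: v => [|c v IH] /=; first by rewrite add0r mul1r.
by rewrite IH opprD addrA; congr (_ + _); case: odd; rewrite /= ?mulN1r ?mul1r ?opprK.
Qed.

(** Every letter is [y] or [~~ y], so the sum is 1 - 1 + 1 - ... ; on words of even length this
    yields d_X = - d_Y. *)
Lemma signed_countN y w :
  signed_count y w + signed_count (~~ y) w = (odd (size w))%:R.
Proof.
elim: w => [|c w IH] //=.
rewrite addrACA -opprD IH -natrD.
have -> : ((c == y) + (c == ~~ y) = 1)%N by case: (c) (y) => [] [].
by case: odd.
Qed.

Lemma signed_count_nseq_even y x k : ~~ odd k -> signed_count y (nseq k x) = 0.
Proof.
move=> k_even; rewrite -(odd_double_half k) (negPf k_even) add0n.
by elim: k./2 => [|n IH] //; rewrite doubleS /= IH subr0 subrr.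
Qed.

Lemma signed_count_nseqN x k : signed_count (~~ x) (nseq k x) = 0.
Proof. by elim: k => [|k IH] //=; rewrite IH; case: x {IH}. Qed.

Definition balanced y w := ~~ odd (size w) && (signed_count y w == 0).

Lemma balanced_cat y v w : balanced y v -> balanced y (v ++ w) = balanced y w.
Proof.
case/andP=> /negPf ev /eqP dv.
by rewrite /balanced signed_count_cat size_cat oddD ev dv add0r mul1r.
Qed.

Lemma balanced_delete y v x k w : ~~ odd k ->
  balanced y (v ++ nseq k x ++ w) = balanced y (v ++ w).
Proof.
move=> k_even; rewrite /balanced !signed_count_cat !size_cat size_nseq !oddD.
by rewrite (negPf k_even) signed_count_nseq_even // add0r mul1r.
Qed.

Fixpoint alt_blocks x (ks : seq nat) : seq bool :=
  if ks is k :: ks' then nseq k x ++ alt_blocks (~~ x) ks' else [::].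

Lemma alt_blocksP w :
  exists x (ks : seq nat), w = alt_blocks x ks /\ all (leq 1) ks.
Proof.
elim: w => [|c w [x [ks [-> pos]]]]; first by exists true, [::].
have [->|/eqP cx] := c =P x.
  case: ks pos => [|k ks] pos; first by exists x, [:: 1%N].
  by exists x, (k.+1 :: ks); split; last by case/andP: pos.
exists c, (1%N :: ks); split=> //=.
by have -> : ~~ c = x by case: c x cx => [] [].
Qed.

(** Kept as a list of factors rather than one word, since Boolean cumulants depend on the
    factors. *)
Definition alternating_words (a b : nat -> seq bool) (p q : nat) :=
  a p.+1 :: flatten [seq [:: b r; a r.+1] | r <- index_iota p.+1 q].

Lemma alternating_words_cat a b p r q : (p < r)%N -> (r < q)%N ->
  alternating_words a b p q =
  alternating_words a b p r ++ b r :: alternating_words a b r q.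
Proof.
move=> pr rq; rewrite /alternating_words /index_iota.
have -> : (q - p.+1 = (r - p.+1) + (q - r.+1).+1)%N.
  by rewrite subnSK // addnC addnBA // subnK // ltnW.
by rewrite iotaD subnKC // map_cat flatten_cat.
Qed.

Lemma flatten_alternating_words a b n :
  flatten (alternating_words a b 0 n.+1) ++ b n.+1 =
  flatten [seq a r ++ b r | r <- iota 1 n.+1].
Proof.
elim: n => [|n IH]; first by rewrite /= !cats0.
rewrite (alternating_words_cat a b (ltn0Sn n) (ltnSn n.+1)).
have -> : iota 1 n.+2 = iota 1 n.+1 ++ [:: n.+2].
  by rewrite -[in LHS](addn1 n.+1) iotaD.
rewrite map_cat !flatten_cat -IH.
by rewrite /alternating_words /index_iota subnn /= !cats0 -!catA.
Qed.

(** Here [s] plays the role of the selected indices in one term of [cond_exp_formula]. A balanced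
    segment has even length, so it neither adds to the count nor flips later signs; the parity of a
    separator [b r] is harmless because the count after it is already zero. *)
Lemma signed_count_alternating_words y a b s p n :
  (forall r, signed_count y (b r) = 0) ->
  path ltn p s -> all (ltn^~ n) s ->
  (forall j, (j < (size s).+1)%N ->
     balanced y (flatten (alternating_words a b (nth 0%N (p :: s) j)
                                                (nth 0%N (rcons s n) j)))) ->
  signed_count y (flatten (alternating_words a b p n)) = 0.
Proof.
move=> b0; elim: s p => [|r s IH] p.
  by move=> _ _ /(_ 0%N isT)/andP[_ /eqP].
case/andP=> pr rs; case/andP=> rn sn good.
have tail0 := IH r rs sn (fun j => good j.+1).
have /andP[_ /eqP head0] := good 0%N isT.
rewrite (alternating_words_cat _ _ pr rn) flatten_cat signed_count_cat head0.
rewrite add0r -[flatten (b r :: _)]/(b r ++ flatten (alternating_words a b r n)).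
by rewrite signed_count_cat tail0 b0 mulr0 addr0 mulr0.
Qed.

End SignedCount.

(** * Vanishing of moments, cumulants and conditional expectations on unbalanced words *)

Section Vanishing.

Variable K : fieldType.
Local Notation A := (ncpoly K).
Implicit Types (mu : {scalar A}) (x y : bool) (v w : seq bool).

Fixpoint centered_blocks mu x (ks : seq nat) : seq A :=
  if ks is k :: ks' then
    ((- mu (gen K x ^+ k)) *: 1 + gen K x ^+ k) :: centered_blocks mu (~~ x) ks'
  else [::].

Lemma centered_blocksP mu x ks : mu 1 = 1 -> forall j, (j < size ks)%N ->
  in_polyalg (gen K (x (+) odd j)) (centered_blocks mu x ks)`_j /\
  mu (centered_blocks mu x ks)`_j = 0.
Proof.
move=> mu1; elim: ks x => [|k ks IH] x [|j] //= jk.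
  rewrite addbF; split.
    by apply: in_polyalg_lin; [exact: (in_polyalg_exp _ 0) | exact: in_polyalg_exp].
  by rewrite linearP mu1 /= mulr1 addNr.
have -> : x (+) ~~ odd j = ~~ x (+) odd j by case: x; case: odd.
exact: IH.
Qed.

Section Moments.

Variable mu : {scalar A}.
Hypothesis mu1 : mu 1 = 1.
Hypothesis mu_free : freely_independent mu.
Hypothesis mu_sym : forall x, symmetric_distribution mu x.

Lemma mu_centered_blocks x ks : ks != [::] ->
  mu (\prod_(c <- centered_blocks mu x ks) c) = 0.
Proof.
have sz z l : size (centered_blocks mu z l) = size l.
  by elim: l z => //= k l IH z; rewrite IH.
move=> ks0; apply: (mu_free (x := x)) => [|j].
  by rewrite -size_eq0 sz size_eq0.
by rewrite sz; apply: centered_blocksP.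
Qed.

(* The prefix v keeps track of the blocks that have been left in place. *)
Lemma mu_subr_centered y n :
  (forall w, (size w < n)%N -> ~~ balanced y w -> mu (mon K w) = 0) ->
  forall ks x v, all (leq 1) ks -> (size (v ++ alt_blocks x ks) <= n)%N ->
  ~~ balanced y (v ++ alt_blocks x ks) ->
  mu (mon K v * (mon K (alt_blocks x ks) -
                 \prod_(c <- centered_blocks mu x ks) c)) = 0.
Proof.
move=> shorter; elim=> [|k ks IH] x v /=.
  by rewrite big_nil mon_nil subrr mulr0 linear0.
case/andP=> k0 pos; rewrite !size_cat size_nseq => sz bad.
rewrite big_cons mon_cat mon_nseq.
set g := gen K x ^+ k; set c := mu g.
set D := mon K (alt_blocks _ _); set C := \prod_(u <- _) u.
(* Either the first block stays and joins the prefix, or it is replaced by its moment [c]. Writing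
   [C] as [D - (D - C)] leaves a shorter word and an instance of the induction hypothesis. *)
have -> : g * D - (- c *: 1 + g) * C = g * (D - C) + c *: (D - (D - C)).
  rewrite subKr mulrDl -scalerAl mul1r scaleNr mulrBr opprD opprK.
  by rewrite -addrA [c *: C + _]addrC.
have head0 : mu (mon K v * (g * (D - C))) = 0.
  rewrite mulrA /g -mon_nseq -mon_cat; apply: IH; rewrite -?catA //.
  by rewrite !size_cat size_nseq.
rewrite mulrDr linearD [X in X + _]head0 add0r ncpolyZr linearZ /=.
(* An odd block has moment zero by symmetry; deleting an even one keeps the word unbalanced and, as
   [0 < k], shortens it strictly. *)
have [k_odd|k_even] := boolP (odd k); first by rewrite /c mu_sym // mul0r.
move: bad; rewrite balanced_delete // => bad.
have sz' : (size (v ++ alt_blocks (~~ x) ks) < n)%N.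
  by rewrite size_cat (leq_trans _ sz) // ltn_add2l -[X in (X < _)%N]add0n ltn_add2r.
rewrite mulrBr linearB /= -mon_cat shorter // IH ?(ltnW sz') //.
by rewrite subrr mulr0.
Qed.

Lemma mu_unbalanced y w : ~~ balanced y w -> mu (mon K w) = 0.
Proof.
elim/ltn_ind: {w}_.+1 {-2}w (ltnSn (size w)) => n IH w wn bad.
have [x [ks [wE pos]]] := alt_blocksP w; rewrite wE in wn bad *.
(* The empty word is balanced, so there is at least one block and freeness applies to the centred
   product. *)
have ks0 : ks != [::] by case: (ks) bad.
have := @mu_subr_centered y (size (alt_blocks x ks)) _ ks x [::] pos.
rewrite mon_nil mul1r linearB /= mu_centered_blocks // subr0; apply=> // v vw.
exact: (IH _ wn).
Qed.

Lemma prod_mon (ws : seq (seq bool)) :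
  \prod_(c <- map (mon K) ws) c = mon K (flatten ws).
Proof.
by elim: ws => [|w ws IH] /=; rewrite ?big_nil ?mon_nil // big_cons IH mon_cat.
Qed.

(** Each term of the recursion cuts the word in two. An unbalanced prefix has zero cumulant by
    induction on the depth; after a balanced prefix the suffix is unbalanced, so its moment
    vanishes. *)
Lemma boolean_cumulant_unbalanced y (ws : seq (seq bool)) :
  ~~ balanced y (flatten ws) -> boolean_cumulant mu (map (mon K) ws) = 0.
Proof.
rewrite /boolean_cumulant; move: (size (map _ _)) => d; elim: d ws => [|d IH] ws //= bad.
rewrite prod_mon (mu_unbalanced bad) sub0r big1 ?oppr0 // => k _.
rewrite -map_take -map_drop prod_mon.
have [good|bad1] := boolP (balanced y (flatten (take k ws))); last first.
  by rewrite IH // mul0r.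
rewrite (@mu_unbalanced y) ?mulr0 //; rewrite -(balanced_cat _ good).
by rewrite -flatten_cat cat_take_drop.
Qed.

Lemma alternating_monE (a b : nat -> seq bool) p q :
  alternating (mon K \o a) (mon K \o b) p q =
  map (mon K) (alternating_words a b p q).
Proof. by rewrite /= map_flatten -map_comp. Qed.

Lemma cond_exp_formula_unbalanced y (a b : nat -> seq bool) n :
  (forall r, signed_count y (b r) = 0) ->
  signed_count y (flatten (alternating_words a b 0 n)) != 0 ->
  cond_exp_formula mu (mon K \o a) (mon K \o b) n = 0.
Proof.
move=> b0 bad; rewrite /cond_exp_formula big1 // => k _; rewrite big1 // => i pi.
set F := (\prod_(j < _) _); suff -> : F = 0 by rewrite scale0r.
(* If no cumulant in the product vanishes, all segments are balanced and the whole count is zero. *)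
apply/eqP; apply: contraNT bad => /prodf_neq0 F0; apply/eqP.
apply: (signed_count_alternating_words b0 pi) => [|j].
  by apply/allP=> _ /mapP[r _ ->]; apply: ltn_ord.
rewrite size_map size_tuple => jk; apply: contraNT (F0 (Ordinal jk) isT) => bad.
by rewrite alternating_monE (boolean_cumulant_unbalanced bad).
Qed.

Lemma cond_exp_unbalanced x w :
  signed_count (~~ x) w != 0 -> cond_exp mu x (mon K w) = 0.
Proof.
move=> bad; rewrite cond_exp_mon /word_exp.
have [p [L [-> wE _]]] := blocksP x w; move: bad; rewrite {}wE.
case: L => [|kl L]; first by rewrite cats0 signed_count_nseqN eqxx.
(* The initial power of [x] only multiplies the count by a sign, which can be cancelled. *)
rewrite signed_count_cat signed_count_nseqN add0r mulrI_eq0; last first.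
  by apply: lregX; apply/mulrI; rewrite unitrN1.
set M := kl :: L => bad.
(* The formula numbers its factors from 1, the list of blocks from 0. *)
pose a i := nseq (nth (0%N, 0%N) M i.-1).1 (~~ x).
pose b i := nseq (nth (0%N, 0%N) M i.-1).2 x.
have block_wordE : block_word x M =
    flatten (alternating_words a b 0 (size M)) ++ b (size M).
  rewrite flatten_alternating_words /block_word -[M in LHS](mkseq_nth (0%N, 0%N)).
  by rewrite /mkseq -map_comp -(addn0 1%N) iotaDl -map_comp.
rewrite /= (_ : cond_exp_formula _ _ _ _ = 0) ?mul0r ?mulr0 //.
rewrite -(@cond_exp_formula_unbalanced (~~ x) a b (size M)).
- by apply: cond_exp_formula_ext => i _; rewrite /= mon_nseq.
- by move=> r; apply: signed_count_nseqN.
apply: contraNneq bad => seg0.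
by rewrite block_wordE signed_count_cat seg0 signed_count_nseqN mulr0 addr0.
Qed.

End Moments.

(** * Expansion of the powers of T_alpha into words *)

Definition letter_pairs (k : nat) : seq (seq bool) :=
  iter k (fun ws => map (cat [:: false; true]) ws ++ map (cat [:: true; false]) ws)
    [:: [::]].

Lemma letter_pairs_even k w : w \in letter_pairs k -> ~~ odd (size w).
Proof.
elim: k w => [|k IH] w; first by rewrite inE => /eqP->.
by rewrite /= mem_cat => /orP[] /mapP[v /IH vk ->] /=; rewrite negbK.
Qed.

(** The pairs XY and YX have d_X equal to 1 and -1, and prepending a pair keeps the parity of later
    positions, so exponents of [t] add up. *)
Lemma expr_letter_pairs (t : K) k : t != 0 ->
  (t *: (gen K false * gen K true) + t^-1 *: (gen K true * gen K false)) ^+ k =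
  \sum_(w <- letter_pairs k) t ^ signed_count false w *: mon K w.
Proof.
move=> t0; elim: k => [|k IH]; first by rewrite big_seq1 mon_nil scale1r.
have -> : letter_pairs k.+1 = map (cat [:: false; true]) (letter_pairs k) ++
  map (cat [:: true; false]) (letter_pairs k) by [].
have pairE (c : K) x y w u :
    c *: (gen K x * gen K y) * (u *: mon K w) = (u * c) *: mon K ([:: x; y] ++ w).
  by rewrite -!mon_gen -!mon_cat ncpolyZr -scalerAl -mon_cat scalerA.
rewrite exprS IH mulrDl [RHS]big_cat.
apply: (congr2 +%R); rewrite mulr_sumr big_map; apply: eq_bigr => w _.
  by rewrite [signed_count _ (_ ++ _)]/= sub0r opprK addrC expfzDr // pairE.
by rewrite [signed_count _ (_ ++ _)]/= sub0r opprB expfzDr // pairE.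
Qed.

(** The right-hand side is free of [t], so any two nonzero values of [t] can be compared through
    it. *)
Lemma cond_exp_expr_pairs (mu : {scalar A}) (E : {linear A -> A}) x (t : K) k :
  mu 1 = 1 -> freely_independent mu -> (forall y, symmetric_distribution mu y) ->
  is_cond_exp mu x E -> t != 0 ->
  E ((t *: (gen K false * gen K true) + t^-1 *: (gen K true * gen K false)) ^+ k) =
  \sum_(w <- letter_pairs k) E (mon K w).
Proof.
move=> mu1 free sym EP t0; rewrite expr_letter_pairs // linear_sum.
apply: eq_big_seq => w /letter_pairs_even ev; rewrite linearZ /=.
have [d0|d0] := eqVneq (signed_count (~~ x) w) 0; last first.
  by rewrite (cond_exp_unique EP) cond_exp_unbalanced // scaler0.
suff -> : signed_count false w = 0 by rewrite expr0z scale1r.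
(* For E_Y the count d_X is zero at once; for E_X it is d_Y that is zero, and even length transfers
   this to d_X. *)
case: x d0 {EP} => //= d0.
by have := signed_countN false w; rewrite d0 addr0 (negPf ev).
Qed.

End Vanishing.

Theorem proposition7p1 (R : realType)
    (mu : {scalar ncpoly R[i]})
    (EX EY : {linear ncpoly R[i] -> ncpoly R[i]}) :
  mu 1 = 1 ->
  freely_independent mu ->
  symmetric_distribution mu false ->
  symmetric_distribution mu true ->
  is_cond_exp mu false EX ->
  is_cond_exp mu true EY ->
  (forall alpha : R[i], `|alpha| = 1 ->
     EX \o resolvent (T_ alpha) =1 EX \o resolvent (T_ 1) /\
     EY \o resolvent (T_ alpha) =1 EY \o resolvent (T_ 1)) /\
  (let X : ncpoly R[i] := gen _ false in
   let Y : ncpoly R[i] := gen _ true in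
   EX \o resolvent ('i *: (X * Y - Y * X)) =1 EX \o resolvent (X * Y + Y * X) /\
   EY \o resolvent ('i *: (X * Y - Y * X)) =1 EY \o resolvent (X * Y + Y * X)).
Proof.
move=> mu1 free symX symY EXP EYP.
have sym x : symmetric_distribution mu x by case: x.
have EP x (E : {linear ncpoly R[i] -> ncpoly R[i]}) : is_cond_exp mu x E ->
    forall alpha, `|alpha| = 1 -> E \o resolvent (T_ alpha) =1 E \o resolvent (T_ 1).
  (* On the unit circle conjugation is inversion, which brings T_alpha into the form with
     coefficients [t] and [t^-1]. *)
  have unit_circle (t : R[i]) : `|t| = 1 -> (t^* = t^-1) /\ t != 0.
    move=> t1; split; first by rewrite invC_norm t1 expr1n invr1 mul1r.
    by rewrite -normr_eq0 t1 oner_eq0.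
  move=> HE alpha a1 k; rewrite /= /resolvent /T_.
  have [-> a0] := unit_circle _ a1; have [-> o0] := unit_circle 1 (normr1 _).
  exact: etrans (cond_exp_expr_pairs k mu1 free sym HE a0)
                (esym (cond_exp_expr_pairs k mu1 free sym HE o0)).
have main alpha a1 := conj (EP _ _ EXP alpha a1) (EP _ _ EYP alpha a1).
split; first exact: main.
move=> X Y.
have Ti : T_ 'i = 'i *: (X * Y - Y * X) by rewrite /T_ conjCi scalerBr scaleNr.
have T1 : T_ 1 = X * Y + Y * X.
  by rewrite /T_ conjC1; congr (_ + _); apply: scale1r.
by rewrite -Ti -T1; apply: main; rewrite normCi.
Qed.
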